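(* Let $D$ and $R$ be positive integers. (a) A $\mathrm{TFF}(D,2,R)$ exists if and only if $R\in\{\frac D2,D\}$. Such TFFs are necessarily equi-isoclinic, and can be chosen to be real. (b) A $\mathrm{TFF}(D,3,R)$ exists if and only if $R\in\{\frac D3,\frac D2,\frac{2D}3,D\}$. Such TFFs are necessarily equi-isoclinic when $R\in\{\frac D3,\frac D2,D\}$, are necessarily equichordal when $R=\frac{2D}3$, and (in all of these cases) can be chosen to be real.
   Context: Let $D,N,R$ be positive integers with $N>1$. A $\mathrm{TFF}(D,N,R)$ (tight fusion frame) is a sequence $\{\mathcal U_n\}_{n=1}^N$ of $R$-dimensional subspaces of a $D$-dimensional complex Hilbert space $\mathcal H$ whose orthogonal projections $\mathbf P_n$ (onto $\mathcal U_n$) satisfy $\sum_{n=1}^N\mathbf P_n=A\mathbf I$ for some $A>0$. It is real if there is a unitary $\mathbf U:\mathbb C^D\to\mathcal H$ such that every matrix $\mathbf U^*\mathbf P_n\mathbf U$ has all real entries; equivalently, it can be realized in $\mathbb R^D$. It is equichordal if $\operatorname{Tr}(\mathbf P_{n_1}\mathbf P_{n_2})$ is constant over all $n_1\neq n_2$ (equivalently, the chordal distance $\frac1{\sqrt2}\|\mathbf P_{n_1}-\mathbf P_{n_2}\|_{\mathrm{Fro}}$ is constant over $n_1\ne n_2$). It is equi-isoclinic if there exists $\lambda\ge 0$ such that $\mathbf P_{n_1}\mathbf P_{n_2}\mathbf P_{n_1}=\lambda\mathbf P_{n_1}$ for all $n_1\neq n_2$. *)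

(* Defs.v *)
From mathcomp Require Export all_boot all_order all_algebra.
From mathcomp Require Export reals complex.

Set Implicit Arguments.
Unset Strict Implicit.
Unset Printing Implicit Defensive.

Import Order.TTheory GRing.Theory Num.Theory.
Local Open Scope ring_scope.

(* A D-dimensional complex Hilbert space is a vectType H over C together with
   a positive definite Hermitian form, {dot H for Num.conj}; completeness is
   automatic in finite dimension. *)

Definition orth_proj (C : numClosedFieldType) (H : vectType C)
    (form : {dot H for Num.conj}) (U : {vspace H}) : 'End(H) :=
  daddv_pi U (orthov form U).

Lemma orth_projP (C : numClosedFieldType) (H : vectType C)
    (form : {dot H for Num.conj}) (U : {vspace H}) (v : H) :
  orth_proj form U v \in U /\ v - orth_proj form U v \in orthov form U.
Proof.
have cap0 : (U :&: orthov form U = 0)%VS.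
  apply/eqP; rewrite -subv0; apply/subvP => u.
  rewrite memv_cap memv0 => /andP[uU /mem_orthovP u_ortho].
  by rewrite -(dnorm_eq0 form) u_ortho.
have split : v \in (U + orthov form U)%VS.
  have [x xU [y [-> _ orth_yU]]] := orthogonal_split form (vbasis U) v.
  rewrite memv_add //; first by rewrite -(span_basis (vbasisP U)).
  apply/mem_orthovP => w /coord_vbasis ->; rewrite linear_sumr big1 // => i _ /=.
  rewrite linearZr_LR /= (orthoPl orth_yU) ?mulr0 //.
  by rewrite mem_nth ?size_tuple.
split; first exact: memv_pi.
rewrite -{1}(daddv_pi_add cap0 split) addrC addKr; exact: memv_pi.
Qed.

Definition lfun_tr (C : numClosedFieldType) (H : vectType C) (f : 'End(H)) : C :=
  \tr (passmx.mxof (vbasis {:H}) (vbasis {:H}) f).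

(* In numClosedFieldType, 0 < A and 0 <= lambda entail that the scalar is real. *)
Definition is_TFF (C : numClosedFieldType) (D N R : nat) (H : vectType C)
    (form : {dot H for Num.conj}) (U : 'I_N -> {vspace H}) : Prop :=
  [/\ \dim {:H} = D,
      forall n, \dim (U n) = R
    & exists2 A : C, 0 < A &
        \sum_(n < N) orth_proj form (U n) = A *: (\1)%VF].

Definition equichordal (C : numClosedFieldType) (N : nat) (H : vectType C)
    (form : {dot H for Num.conj}) (U : 'I_N -> {vspace H}) : Prop :=
  exists c : C, forall n1 n2 : 'I_N, n1 != n2 ->
    lfun_tr (orth_proj form (U n1) \o orth_proj form (U n2))%VF = c.

Definition equi_isoclinic (C : numClosedFieldType) (N : nat) (H : vectType C)
    (form : {dot H for Num.conj}) (U : 'I_N -> {vspace H}) : Prop :=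
  exists2 lambda : C, 0 <= lambda & forall n1 n2 : 'I_N, n1 != n2 ->
    (orth_proj form (U n1) \o orth_proj form (U n2) \o orth_proj form (U n1))%VF
      = lambda *: orth_proj form (U n1).

(* C^D is 'rV[C]_D with its standard inner product dotmx. *)
Definition unitary (C : numClosedFieldType) (D : nat) (H : vectType C)
    (form : {dot H for Num.conj}) (T : 'Hom('rV[C]_D, H)) : Prop :=
  isometry form (@dotmx C D) T /\ limg T = fullv.

(* For T unitary, T^-1 = T^*.  lin1_mx is the matrix in the standard basis,
   acting on row vectors: it is the transpose of the matrix acting on columns,
   which does not affect whether the entries are real. *)
Definition is_real (C : numClosedFieldType) (D N : nat) (H : vectType C)
    (form : {dot H for Num.conj}) (U : 'I_N -> {vspace H}) : Prop :=
  exists2 T : 'Hom('rV[C]_D, H), unitary form T &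
    forall n, lin1_mx (T^-1 \o orth_proj form (U n) \o T)%VF
                \is a mxOver Num.real.

Definition TFF_exists (C : numClosedFieldType) (D N R : nat) : Prop :=
  exists (H : vectType C) (form : {dot H for Num.conj}) (U : 'I_N -> {vspace H}),
    is_TFF D R form U.

Definition real_TFF_exists (C : numClosedFieldType) (D N R : nat) : Prop :=
  exists (H : vectType C) (form : {dot H for Num.conj}) (U : 'I_N -> {vspace H}),
    is_TFF D R form U /\ is_real D form U.

(* Main.v *)
Require Import Defs.
From mathcomp Require Import ring mxtens.

(** Write the fusion frame identity as P_1 + ... + P_N = A I; traces give
    N R = A D.  For N = 2, squaring P_2 = A - P_1 gives
    2 (A - 1) P_1 = A (A - 1) I, so that A = 1 or P_1 = I.  For N = 3, squaring
    P_3 = A - P_1 - P_2 gives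
      P_1 P_2 + P_2 P_1 = 2 (A - 1) (P_1 + P_2) + (A - A^2) I,
    whose trace shows that the frame is always equichordal.  Multiplying by P_1
    on either side and comparing, (2 A - 3) (P_1 P_2 - P_2 P_1) = 0: either
    A = 3/2, or all projections commute, which forces A to be 1, 2 or 3.
    Moreover P_1 P_2 P_1 = (A - 1)/2 P_1 as soon as A <> 2.

    Conversely, real examples arise by tensoring small real projection matrices
    with an identity matrix: coordinate lines, their complements, the
    whole space, and three lines of the plane at mutual angle 60 degrees. *)

Set Implicit Arguments.
Unset Strict Implicit.
Unset Printing Implicit Defensive.

Import Order.TTheory GRing.Theory Num.Theory.
Import passmx.
Local Open Scope ring_scope.
Local Open Scope complex_scope.

(** * Orthogonal projections and traces of endomorphisms *)

Section OrthogonalProjection.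

Variables (C : numClosedFieldType) (H : vectType C) (form : {dot H for Num.conj}).
Implicit Types (U : {vspace H}) (f g : 'End(H)).

(** The difference of the two candidates lies both in [U] and in its orthogonal complement, so it is
    orthogonal to itself and vanishes by definiteness. *)
Lemma orth_proj_unique U v w :
  w \in U -> v - w \in orthov form U -> orth_proj form U v = w.
Proof.
move=> wU vwU; have [pU vpU] := orth_projP form U v.
set p := orth_proj form U v in pU vpU *.
have dU : p - w \in U by rewrite rpredB.
have /mem_orthovP/(_ _ dU)/eqP : p - w \in orthov form U.
  by rewrite -(subrKA v) addrC -(opprB v p) rpredB.
by rewrite dnorm_eq0 subr_eq0 => /eqP.
Qed.

Lemma orth_proj_id U u : u \in U -> orth_proj form U u = u.
Proof. by move=> uU; apply: orth_proj_unique => //; rewrite subrr mem0v. Qed.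

Lemma orth_proj_idem U :
  (orth_proj form U \o orth_proj form U)%VF = orth_proj form U.
Proof.
apply/lfunP => v; rewrite comp_lfunE orth_proj_id //.
by have [] := orth_projP form U v.
Qed.

Lemma lfun_trE f :
  lfun_tr f = \sum_i coord (vbasis {:H}) i (f (vbasis {:H})`_i).
Proof.
apply: eq_bigr => i _; rewrite !mxE /=.
by rewrite vecof_delta.
Qed.

(** Since [f] takes its values in [U], its trace equals that of its restriction to [U], which is the
    identity there. Both bases are used: each [f e_j] is expanded in the basis of [U], the sums are
    exchanged, and the [e_j] are recombined. *)
Lemma lfun_tr_proj f U :
  (forall v, f v \in U) -> {in U, forall u, f u = u} ->
  lfun_tr f = (\dim U)%:R.
Proof.
move=> fU fid; rewrite lfun_trE.
set e := vbasis {:H}; set b := vbasis U.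
transitivity (\sum_(i < \dim U) coord b i (f b`_i)).
  have fE j : f e`_j = \sum_(i < \dim U) coord b i (f e`_j) *: b`_i.
    exact: coord_vbasis (fU _).
  under eq_bigr => j _ do rewrite fE linear_sum /=.
  rewrite exchange_big /=; apply: eq_bigr => i _.
  rewrite [in RHS](coord_vbasis (memvf b`_i)) !linear_sum /=.
  by apply: eq_bigr => j _; rewrite !linearZ /= mulrC.
rewrite -[RHS]mulr1 mulr_natl -[\dim U in RHS]card_ord -sumr_const.
apply: eq_bigr => i _; rewrite fid ?vbasis_mem ?mem_nth ?size_tuple //.
by rewrite coord_free ?eqxx // (basis_free (vbasisP U)).
Qed.

Lemma lfun_tr_orth_proj U : lfun_tr (orth_proj form U) = (\dim U)%:R.
Proof.
apply: lfun_tr_proj; last exact: orth_proj_id.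
by move=> v; have [] := orth_projP form U v.
Qed.

Lemma lfun_trD f g : lfun_tr (f + g) = lfun_tr f + lfun_tr g.
Proof. by rewrite /lfun_tr linearD mxtraceD. Qed.

Lemma lfun_trZ a f : lfun_tr (a *: f) = a * lfun_tr f.
Proof. by rewrite /lfun_tr linearZ mxtraceZ. Qed.

Lemma lfun_tr_sum I (r : seq I) (F : I -> 'End(H)) :
  lfun_tr (\sum_(i <- r) F i) = \sum_(i <- r) lfun_tr (F i).
Proof. by rewrite /lfun_tr !linear_sum. Qed.

Lemma lfun_tr_compC f g : lfun_tr (f \o g)%VF = lfun_tr (g \o f)%VF.
Proof.
by rewrite /lfun_tr !(mxof_comp _ _ (vbasisP {:H})) mxtrace_mulC.
Qed.

Lemma lfun_tr1 : lfun_tr (\1%VF : 'End(H)) = (\dim {:H})%:R.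
Proof. by apply: lfun_tr_proj => [v|u _]; rewrite ?memvf ?lfunE. Qed.

End OrthogonalProjection.

(** * From real symmetric idempotent matrices to real frames *)

Lemma lfun_tr_rV (C : numClosedFieldType) D (P : 'M[C]_D) :
  lfun_tr (linfun (mulmxr P) : 'End('rV[C]_D)) = \tr P.
Proof.
rewrite /lfun_tr /mxof.
set e := vbasis _.
have eP : basis_of {:'rV[C]_D} e := vbasisP _.
(* The basis [e] need not be the standard one. [V] and [W] are the transition matrices, and
   conjugation preserves the trace. *)
pose V := lin1_mx (vecof e); pose W := lin1_mx (rVof e).
have WV : W *m V = 1%:M.
  apply/row_matrixP => i; rewrite !rowE mulmxA /W /V !mul_rV_lin1 mulmx1.
  exact: rVofK.
transitivity (\tr (V *m P *m W)).
  congr mxtrace; apply/row_matrixP => i.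
  by rewrite !rowE /W /V !mulmxA !mul_rV_lin1 /= lfunE.
by rewrite -mulmxA mxtrace_mulC -mulmxA WV mulmx1.
Qed.

(** A real symmetric idempotent matrix is the orthogonal projection onto its image, whose dimension
    is its trace. Realness is witnessed by the identity of the standard space. *)
Lemma real_TFF_of_mx (C : numClosedFieldType) (D N R : nat)
    (P : 'I_N -> 'M[C]_D) (A : C) :
  (forall n, P n \is a mxOver Num.real) -> (forall n, (P n)^T = P n) ->
  (forall n, P n *m P n = P n) -> (forall n, \tr (P n) = R%:R) ->
  0 < A -> \sum_n P n = A%:M -> real_TFF_exists C D N R.
Proof.
move=> Preal Psym Pidem Ptr A_gt0 sumP.
pose f n : 'End('rV[C]_D) := linfun (mulmxr (P n)).
have fE n v : f n v = v *m P n by rewrite lfunE.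
pose form : {dot 'rV[C]_D for Num.conj} := @dotmx C D.
have Pf n : orth_proj form (limg (f n)) = f n.
  apply/lfunP => v; apply: orth_proj_unique; first exact: memv_img (memvf v).
  apply/mem_orthovP => _ /memv_imgP[u _ ->]; rewrite !fE.
  rewrite [LHS]dotmxE.
  rewrite trmx_mul Psym map_mxM.
  have -> : map_mx Num.conj (P n) = P n.
    by apply/matrixP => i j; rewrite mxE conj_Creal //; apply/mxOverP.
  by rewrite mulmxA mulmxBl -mulmxA Pidem subrr mul0mx mxE.
exists 'rV[C]_D, form, (fun n => limg (f n)); split; first split.
- rewrite dimvf dim_matrix. exact: mul1n.
- move=> n; apply/eqP; rewrite -(eqr_nat C) -(lfun_tr_orth_proj form) Pf.
  by rewrite lfun_tr_rV Ptr.
- exists A => //; apply/lfunP => v; rewrite sum_lfunE !lfunE /= lfunE /=.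
  under eq_bigr do rewrite Pf fE.
  by rewrite -mulmx_sumr sumP mul_mx_scalar.
exists \1%VF; first by split; [move=> u v; rewrite !lfunE | rewrite lim1g].
move=> n; rewrite Pf.
have -> : (\1^-1 = \1 :> 'End('rV[C]_D))%VF.
  rewrite -[LHS]comp_lfun1r lker0_compVf //.
  by apply/lker0P => u v; rewrite !id_lfunE.
rewrite comp_lfun1l comp_lfun1r (_ : lin1_mx _ = P n) //.
by apply/row_matrixP => i; rewrite !rowE mul_rV_lin1; exact: fE.
Qed.

Lemma mxtrace_tens (R : pzRingType) m k (P : 'M[R]_m) (Q : 'M[R]_k) :
  \tr (P *t Q) = \tr P * \tr Q.
Proof. by rewrite /mxtrace mulr_sum; apply: eq_bigr => i _; rewrite mxE. Qed.

Lemma tens_scalar_mx1 (R : pzRingType) m k (a : R) :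
  a%:M *t 1%:M = a%:M :> 'M_(m * k).
Proof.
apply/matrixP => i j.
case: (mxtens_indexP i) => i0 i1; case: (mxtens_indexP j) => j0 j1.
rewrite tensmxE !mxE (can_eq (@mxtens_indexK m k)) xpair_eqE.
by case: eqP; case: eqP; rewrite ?mulr1 ?mulr0.
Qed.

(** Tensoring with the identity of size [k] preserves every condition and the frame constant, and
    multiplies both the dimension and the rank by [k]. *)
Lemma real_TFF_tens (C : numClosedFieldType) (m N r k : nat)
    (P : 'I_N -> 'M[C]_m) (A : C) :
  (forall n, P n \is a mxOver Num.real) -> (forall n, (P n)^T = P n) ->
  (forall n, P n *m P n = P n) -> (forall n, \tr (P n) = r%:R) ->
  0 < A -> \sum_n P n = A%:M -> real_TFF_exists C (m * k) N (r * k).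
Proof.
move=> Preal Psym Pidem Ptr A_gt0 sumP.
apply: (real_TFF_of_mx (P := fun n => P n *t 1%:M) _ _ _ _ A_gt0).
- move=> n; apply/mxOverP => i j; rewrite mxE rpredM ?(mxOverP (Preal n)) //.
  by apply: (mxOverP (mxOver_scalar _ _)); rewrite ?rpred0 ?rpred1.
- by move=> n; rewrite trmx_tens Psym trmx1.
- by move=> n; rewrite tensmx_mul Pidem mulmx1.
- by move=> n; rewrite mxtrace_tens mxtrace1 Ptr natrM.
have -> : \sum_n P n *t (1%:M : 'M_k) = (\sum_n P n) *t (1%:M : 'M_k).
  apply/matrixP => i j; rewrite !(summxE, mxE) mulr_suml.
  apply: eq_bigr => n _. by rewrite !mxE.
by rewrite sumP tens_scalar_mx1.
Qed.

(** * Two or three idempotents with a scalar sum *)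

Section SumsOfIdempotents.

Variables (C : numFieldType) (H : vectType C).
Implicit Types (p q r : 'End(H)) (a : C).

(* Composing endomorphisms is not a ring structure known to the ring tactic, so
   identities between them are checked on scalar coordinates. *)
Lemma lfun_coordP (f g : 'End(H)) :
  (forall v i, coord (vbasis {:H}) i (f v) = coord (vbasis {:H}) i (g v)) ->
  f = g.
Proof.
move=> fg; apply/lfunP => v.
rewrite [LHS](coord_vbasis (memvf _)) [RHS](coord_vbasis (memvf _)).
by apply: eq_bigr => i _; rewrite fg.
Qed.

Lemma two_idem_sum p q a :
  (p \o p = p)%VF -> (q \o q = q)%VF -> p + q = a *: \1%VF ->
  (2 * (a - 1)) *: p = (a * (a - 1)) *: \1%VF.
Proof.
move=> pp qq sum_pq; apply: lfun_coordP => v i.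
have ppE u : p (p u) = p u by rewrite -comp_lfunE pp.
have qE u : q u = a *: u - p u.
  by rewrite -[q](addKr p) sum_pq !(lfun_simp, id_lfunE) addrC.
have /eqP := congr1 (fun f : 'End(H) => coord (vbasis {:H}) i (f v)) qq.
rewrite -subr_eq0 comp_lfunE !qE !(linearB, linearZ) /= ppE => /eqP h.
rewrite !(lfun_simp, id_lfunE) !linearZ /=.
(* With q = a - p, the relation q q - q = 0 is the opposite of the difference of the two sides. *)
by apply/eqP; rewrite -subr_eq0 -oppr_eq0 -[X in _ == X]h; apply/eqP; ring.
Qed.

(** Substituting q = a - p gives p (a - p) p = (a - 1) p. *)
Lemma two_idem_sandwich p q a :
  (p \o p = p)%VF -> p + q = a *: \1%VF -> (p \o q \o p)%VF = (a - 1) *: p.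
Proof.
move=> pp sum_pq; apply/lfunP => v.
have ppE u : p (p u) = p u by rewrite -comp_lfunE pp.
rewrite -[q](addKr p) sum_pq !(lfun_simp, id_lfunE) ppE.
by rewrite linearD linearN linearZ /= !ppE scalerBl scale1r addrC.
Qed.

Lemma three_idem_sum p q r a :
  (p \o p = p)%VF -> (q \o q = q)%VF -> (r \o r = r)%VF ->
  p + q + r = a *: \1%VF ->
  ((p \o q) + (q \o p))%VF = (2 * (a - 1)) *: (p + q) + (a - a ^+ 2) *: \1%VF.
Proof.
move=> pp qq rr sum_pqr; apply: lfun_coordP => v i.
have ppE u : p (p u) = p u by rewrite -comp_lfunE pp.
have qqE u : q (q u) = q u by rewrite -comp_lfunE qq.
have rE u : r u = a *: u - p u - q u.
  rewrite -[r](addKr (p + q)) sum_pqr !(lfun_simp, id_lfunE).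
  by rewrite opprD addrC addrA.
have /eqP := congr1 (fun f : 'End(H) => coord (vbasis {:H}) i (f v)) rr.
rewrite -subr_eq0 comp_lfunE !rE !(linearB, linearZ) /= ppE qqE => /eqP h.
rewrite !(lfun_simp, id_lfunE) !(linearD, linearZ) /=.
by apply/eqP; rewrite -subr_eq0 -[X in _ == X]h; apply/eqP; ring.
Qed.

Section Three.

Variables (p q r : 'End(H)) (a : C).
Hypotheses (pp : (p \o p = p)%VF) (qq : (q \o q = q)%VF).
Hypotheses (rr : (r \o r = r)%VF) (sum_pqr : p + q + r = a *: \1%VF).

Let ppE u : p (p u) = p u. Proof. by rewrite -comp_lfunE pp. Qed.

(** This is [three_idem_sum] composed with [p] on the left; the next lemma composes on the right. *)
Lemma three_idem_sandwichl :
  (p \o q \o p = ((a - 1) * (2 - a)) *: p + (2 * a - 3) *: (p \o q))%VF.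
Proof.
have E := three_idem_sum pp qq rr sum_pqr.
apply: lfun_coordP => v i.
have /eqP := congr1 (fun f : 'End(H) => coord (vbasis {:H}) i (p (f v))) E.
rewrite -subr_eq0 !(lfun_simp, id_lfunE) !(linearD, linearZ) /= !ppE.
move=> /eqP h.
by apply/eqP; rewrite -subr_eq0 -[X in _ == X]h; apply/eqP; ring.
Qed.

Lemma three_idem_sandwichr :
  (p \o q \o p = ((a - 1) * (2 - a)) *: p + (2 * a - 3) *: (q \o p))%VF.
Proof.
have E := three_idem_sum pp qq rr sum_pqr.
apply: lfun_coordP => v i.
have /eqP := congr1 (fun f : 'End(H) => coord (vbasis {:H}) i (f (p v))) E.
rewrite -subr_eq0 !(lfun_simp, id_lfunE) !(linearD, linearZ) /= ppE.
move=> /eqP h.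
by apply/eqP; rewrite -subr_eq0 -[X in _ == X]h; apply/eqP; ring.
Qed.

Lemma three_idem_commute : 2 * a != 3 -> (p \o q = q \o p)%VF.
Proof.
move=> a_neq; have := three_idem_sandwichl.
rewrite three_idem_sandwichr => /addrI/eqP.
rewrite eq_sym -subr_eq0 -scalerBr scaler_eq0 subr_eq0 (negPf a_neq).
by rewrite subr_eq0 => /eqP.
Qed.

(** Commutation turns p q p into p q, and the sandwich formula becomes 2 (2 - a) p q = (a - 1) (2 -
    a) p, where 2 - a cancels. *)
Lemma three_idem_comp :
  2 * a != 3 -> a != 2 -> (p \o q)%VF = ((a - 1) / 2) *: p.
Proof.
move=> a_neq a_neq2; have cpq := three_idem_commute a_neq.
have pqp : (p \o q \o p = p \o q)%VF by rewrite cpq -comp_lfunA pp.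
have a2 : (2 - a) != 0 by rewrite subr_eq0 eq_sym.
have := three_idem_sandwichl; rewrite pqp => /eqP.
rewrite -subr_eq -{1}[(p \o q)%VF]scale1r -scalerBl => /eqP h.
apply: (scalerI (_ : 2 * (2 - a) != 0)); first by rewrite mulf_neq0 // pnatr_eq0.
transitivity (((a - 1) * (2 - a)) *: p); last first.
  by rewrite scalerA; congr (_ *: _); field.
by rewrite -h; congr (_ *: _); ring.
Qed.

Lemma three_idem_sandwich :
  a != 2 -> (p \o q \o p)%VF = ((a - 1) / 2) *: p.
Proof.
move=> a_neq2; have [a32 | a_neq] := eqVneq (2 * a) 3; last first.
  by rewrite three_idem_comp // -comp_lfunZl pp.
have -> : a = 3 / 2 by rewrite -a32; field.
(* At a = 3/2 the p q term drops out, and (a - 1) (2 - a) and (a - 1) / 2 are both 1/4. *)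
rewrite three_idem_sandwichl a32 subrr scale0r addr0; congr (_ *: _).
have -> : a = 3 / 2 by rewrite -a32; field.
by field.
Qed.

End Three.

(** Away from the first three values, p q = c p and q p = c q with c = (a - 1) / 2 nonzero.
    Commutation then forces p = q, so p = c p and c = 1, that is a = 3. *)
Lemma three_idem_scalar p q r a :
  (p \o p = p)%VF -> (q \o q = q)%VF -> (r \o r = r)%VF ->
  p + q + r = a *: \1%VF -> p != 0 ->
  [\/ a = 1, 2 * a = 3, a = 2 | a = 3].
Proof.
move=> pp qq rr sum_pqr p_neq0.
have [a1|a1] := eqVneq a 1; first by constructor 1.
have [a32|a32] := eqVneq (2 * a) 3; first by constructor 2.
have [a2|a2] := eqVneq a 2; first by constructor 3.
constructor 4.
have pqE := three_idem_comp pp qq rr sum_pqr a32 a2.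
have sum_qpr : q + p + r = a *: \1%VF by rewrite (addrC q).
have qpE := three_idem_comp qq pp rr sum_qpr a32 a2.
have a1' : (a - 1) / 2 != 0 by rewrite mulf_neq0 ?subr_eq0 ?invr_eq0 ?pnatr_eq0.
have pq : p = q.
  apply: (scalerI a1').
  by rewrite -pqE -qpE (three_idem_commute pp qq rr sum_pqr).
move/eqP: pqE; rewrite -pq pp -subr_eq0 -{1}[p]scale1r -scalerBl scaler_eq0.
rewrite (negPf p_neq0) orbF => /eqP h.
by apply/eqP; rewrite -subr_eq0 -(mulr0 (-2)) -h; apply/eqP; field.
Qed.

End SumsOfIdempotents.

(** * Dimensions and geometry of frames of two or three subspaces *)

Section TightFusionFrames.

Variables (C : numClosedFieldType) (H : vectType C) (form : {dot H for Num.conj}).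
Variables (D R : nat).

Lemma TFF_const N (U : 'I_N -> {vspace H}) (A : C) :
  \dim {:H} = D -> (forall n, \dim (U n) = R) ->
  \sum_n orth_proj form (U n) = A *: \1%VF -> N%:R * R%:R = A * D%:R.
Proof.
move=> dimH dimU sumU; have := congr1 (@lfun_tr C H) sumU.
rewrite lfun_tr_sum lfun_trZ lfun_tr1 dimH => <-.
under eq_bigr do rewrite lfun_tr_orth_proj dimU.
by rewrite sumr_const card_ord mulr_natl.
Qed.

Lemma orth_proj_neq0 (U : {vspace H}) : (0 < \dim U)%N -> orth_proj form U != 0.
Proof.
move=> U_gt0; apply/eqP => /(congr1 (@lfun_tr C H)).
rewrite lfun_tr_orth_proj -(scale0r 0) lfun_trZ mul0r => /eqP.
by rewrite pnatr_eq0 -leqn0 leqNgt U_gt0.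
Qed.

Hypotheses (R_gt0 : (0 < R)%N).

Lemma TFF2_dim (U : 'I_2 -> {vspace H}) :
  is_TFF D R form U -> D = (2 * R)%N \/ D = R.
Proof.
move=> [dimH dimU [A A_gt0 sumU]]; have trE := TFF_const dimH dimU sumU.
move: sumU; rewrite !big_ord_recl big_ord0 addr0.
set p := orth_proj form _; set q := orth_proj form _ => sum_pq.
have p_neq0 : p != 0 by rewrite orth_proj_neq0 ?dimU.
have E : (2 * (A - 1)) *: p = (A * (A - 1)) *: \1%VF.
  exact: two_idem_sum (orth_proj_idem _ _) (orth_proj_idem _ _) sum_pq.
have [A1 | A1] := eqVneq A 1.
  by left; apply/eqP; rewrite -(eqr_nat C) natrM trE A1 mul1r.
right; apply/eqP; rewrite -(eqr_nat C); apply/eqP.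
have A1' : A - 1 != 0 by rewrite subr_eq0.
have {}E : 2 *: p = A *: \1%VF.
  by apply: (scalerI A1'); rewrite !scalerA mulrC E; congr (_ *: _); rewrite mulrC.
(* Composing 2 p = A I with p gives 2 p = A p, hence A = 2 because p is nonzero. *)
have /eqP : 2 *: p = A *: p.
  have pp : (p \o p)%VF = p by exact: orth_proj_idem.
  by rewrite -{1}pp comp_lfunZl E -comp_lfunZl comp_lfun1l.
rewrite -subr_eq0 -scalerBl scaler_eq0 (negPf p_neq0) orbF subr_eq0 => /eqP A2.
by apply: (mulfI (_ : 2 != 0 :> C)); rewrite ?pnatr_eq0 // trE A2.
Qed.

Lemma TFF2_equi_isoclinic (U : 'I_2 -> {vspace H}) :
  is_TFF D R form U -> equi_isoclinic form U.
Proof.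
move=> UTFF; move: (UTFF) => [dimH dimU [A A_gt0 sumU]].
have trE := TFF_const dimH dimU sumU.
have R0 : R%:R != 0 :> C by rewrite pnatr_eq0 -lt0n.
exists (A - 1).
  (* The two possible dimensions give A = 1 and A = 2, so A - 1 is 0 or 1. *)
  rewrite subr_ge0; case: (TFF2_dim UTFF) trE => ->.
    rewrite natrM -{1}[2%:R * _]mul1r => /mulIf <- //.
    by rewrite mulf_neq0 // pnatr_eq0.
  by move/(mulIf R0) <-; rewrite ler1n.
move=> n1 n2 n12.
have sumE : \sum_n orth_proj form (U n) =
    orth_proj form (U n1) + orth_proj form (U n2).
  rewrite (bigD1 n1) //= (big_pred1 n2) // => j.
  by move: n1 n2 j n12 => [[|[|//]] ?] [[|[|//]] ?] [[|[|//]] ?].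
exact: two_idem_sandwich (orth_proj_idem _ _) (etrans (esym sumE) sumU).
Qed.

Lemma sum_ord3 (V : zmodType) (F : 'I_3 -> V) n1 n2 : n1 != n2 ->
  exists n3, \sum_n F n = F n1 + F n2 + F n3.
Proof.
(* In ['I_3], with addition modulo 3, the three indices sum to 0, so the remaining one is minus the
   sum of the other two. *)
move=> n12; exists (- (n1 + n2)).
rewrite (bigD1 n1) //= (bigD1 n2) 1?eq_sym //= addrA.
rewrite (big_pred1 (- (n1 + n2))) // => j.
by move: n1 n2 j n12 => [[|[|[|//]]] ?] [[|[|[|//]]] ?] [[|[|[|//]]] ?].
Qed.

Lemma TFF3_dim (U : 'I_3 -> {vspace H}) :
  is_TFF D R form U ->
  [\/ D = (3 * R)%N, D = (2 * R)%N, (2 * D)%N = (3 * R)%N | D = R].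
Proof.
move=> [dimH dimU [A A_gt0 sumU]]; have trE := TFF_const dimH dimU sumU.
have [n3 sumE] := sum_ord3 (fun n => orth_proj form (U n))
  (isT : ord0 != ord_max :> 'I_3).
rewrite sumE in sumU.
have p_neq0 : orth_proj form (U ord0) != 0 by rewrite orth_proj_neq0 ?dimU.
have idem n := orth_proj_idem form (U n).
have n3' : 3 != 0 :> C by rewrite pnatr_eq0.
(* The values A = 1, 3/2, 2, 3 are converted into dimensions by 3 R = A D. *)
case: (three_idem_scalar (idem _) (idem _) (idem _) sumU p_neq0) => AE;
  [constructor 1|constructor 2|constructor 3|constructor 4];
  apply/eqP; rewrite -(eqr_nat C) ?natrM; apply/eqP.
- by rewrite trE AE mul1r.
- by apply: (mulfI n3'); rewrite mulrCA trE mulrA AE.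
- by rewrite trE AE.
- by apply: (mulfI n3'); rewrite trE AE.
Qed.

Lemma TFF3_equichordal (U : 'I_3 -> {vspace H}) :
  is_TFF D R form U -> equichordal form U.
Proof.
move=> [dimH dimU [A A_gt0 sumU]].
(* Half the trace of the right-hand side of [three_idem_sum]; on the left, P_1 P_2 and P_2 P_1 have
   the same trace. *)
exists (((2 * (A - 1)) * (R + R)%:R + (A - A ^+ 2) * D%:R) / 2) => n1 n2 n12.
have [n3 sumE] := sum_ord3 (fun n => orth_proj form (U n)) n12.
have idem n := orth_proj_idem form (U n).
have := three_idem_sum (idem _) (idem _) (idem _) (etrans (esym sumE) sumU).
move/(congr1 (@lfun_tr C H)).
rewrite !lfun_trD !lfun_trZ lfun_trD lfun_tr1 !lfun_tr_orth_proj !dimU dimH.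
rewrite (lfun_tr_compC (orth_proj form (U n2))) -natrD => <-.
by rewrite -mulr2n -(mulr_natr (lfun_tr _)) mulfK ?pnatr_eq0.
Qed.

(** By 3 R = A D, the excluded dimension is the one that A = 2 would force, so [three_idem_sandwich]
    applies. Its factor (A - 1) / 2 is nonnegative because every admissible A is at least 1. *)
Lemma TFF3_equi_isoclinic (U : 'I_3 -> {vspace H}) :
  is_TFF D R form U -> (2 * D)%N <> (3 * R)%N -> equi_isoclinic form U.
Proof.
move=> UTFF neqDR; move: (UTFF) => [dimH dimU [A A_gt0 sumU]].
have trE := TFF_const dimH dimU sumU.
have idem n := orth_proj_idem form (U n).
have A2 : A != 2.
  apply/eqP => A2; apply: neqDR; apply/eqP.
  by rewrite -(eqr_nat C) !natrM trE A2.
exists ((A - 1) / 2).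
  have [n3 sumE] := sum_ord3 (fun n => orth_proj form (U n))
  (isT : ord0 != ord_max :> 'I_3).
  have p_neq0 : orth_proj form (U ord0) != 0 by rewrite orth_proj_neq0 ?dimU.
  rewrite divr_ge0 ?ler0n // subr_ge0.
  case: (three_idem_scalar (idem _) (idem _) (idem _)
           (etrans (esym sumE) sumU) p_neq0).
  - by move->.
  - by move=> AE; rewrite -(ler_pM2l (ltr0Sn C 1)) AE mulr1 ler_nat.
  - by move->; rewrite ler1n.
  - by move->; rewrite ler1n.
move=> n1 n2 n12; have [n3 sumE] := sum_ord3 (fun n => orth_proj form (U n)) n12.
exact: three_idem_sandwich (idem _) (idem _) (idem _)
  (etrans (esym sumE) sumU) A2.
Qed.

End TightFusionFrames.

(** * Real examples *)

Section Constructions.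

Variable C : numClosedFieldType.

Lemma real_TFF_full (D N : nat) : (0 < N)%N -> real_TFF_exists C D N D.
Proof.
move=> N_gt0.
apply: (real_TFF_of_mx (P := fun=> 1%:M) (A := N%:R)) => //; rewrite ?ltr0n //.
- by move=> _; rewrite mxOver_scalar ?rpred0 ?rpred1.
- by move=> _; rewrite trmx1.
- by move=> _; rewrite mulmx1.
- by move=> _; rewrite mxtrace1.
- by rewrite sumr_const card_ord -scaler_nat scalemx1.
Qed.

(** For a real unit row vector u, the matrix u^T u is the projection onto the line of u; these
    rank-one projections are then tensored with the identity. *)
Lemma real_TFF_vectors (m N k : nat) (u : 'I_N -> 'rV[C]_m) (A : C) :
  (forall n, u n \is a mxOver Num.real) -> (forall n, u n *m (u n)^T = 1%:M) ->
  0 < A -> \sum_n (u n)^T *m u n = A%:M -> real_TFF_exists C (m * k) N k.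
Proof.
move=> ureal unorm A_gt0 sumu; rewrite -[X in real_TFF_exists _ _ _ X]mul1n.
apply: (real_TFF_tens k _ _ _ _ A_gt0 sumu) => n.
- rewrite mxOverM //; apply/mxOverP => i j; rewrite mxE.
  exact: (mxOverP (ureal n)).
- by rewrite trmx_mul trmxK.
- by rewrite mulmxA -[_ *m _ *m (u n)^T]mulmxA unorm mulmx1.
- by rewrite mxtrace_mulC unorm mxtrace1.
Qed.

Lemma real_TFF_partition (N k : nat) : real_TFF_exists C (N * k) N k.
Proof.
apply: (@real_TFF_vectors N N k (fun n => delta_mx 0 n) 1) => //.
- move=> n; apply/mxOverP => i j; rewrite mxE; case: andb; rewrite ?rpred0 ?rpred1 //.
- by move=> n; rewrite trmx_delta mul_delta_mx; apply/matrixP => i j; rewrite !ord1 !mxE.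
under eq_bigr do rewrite trmx_delta mul_delta_mx.
by rewrite mx1_sum_delta.
Qed.

Lemma real_TFF_complement (N k : nat) :
  (1 < N)%N -> real_TFF_exists C (N * k) N (N.-1 * k).
Proof.
move=> N_gt1; pose P n : 'M[C]_N := 1%:M - delta_mx n n.
(* The projections onto the coordinate lines sum to I, so their complements sum to (N - 1) I. *)
apply: (real_TFF_tens k (P := P) (A := N%:R - 1)).
- move=> n; apply/mxOverP => i j; rewrite !mxE rpredB //.
    by case: eqP; rewrite ?rpred0 ?rpred1.
  by case: andb; rewrite ?rpred0 ?rpred1.
- by move=> n; rewrite /P linearB /= trmx1 trmx_delta.
- by move=> n; rewrite /P mulmxBl mul1mx mulmxBr mulmx1 mul_delta_mx subrr subr0.
- move=> n; rewrite /P linearB /= mxtrace1 -(mul_delta_mx (ord0 : 'I_1)).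
  rewrite mxtrace_mulC mul_delta_mx.
  by rewrite /mxtrace big_ord1 mxE eqxx -subn1 natrB // ltnW.
- by rewrite subr_gt0 ltr1n.
by rewrite sumrB -mx1_sum_delta sumr_const card_ord -scaler_nat scalemx1 -raddfB.
Qed.

Lemma real_TFF_mercedes_benz (k : nat) : real_TFF_exists C (2 * k) 3 k.
Proof.
pose s : C := sqrtC 3.
have ss : s * s = 3 by rewrite -expr2 sqrtCK.
have sreal : s \is Num.real by rewrite realE sqrtC_ge0 ler0n.
(* The coordinates of three unit vectors at mutual angles of 120 degrees; they span lines at 60
   degrees. *)
pose x (n : 'I_3) : C := [:: 1; - 2^-1; - 2^-1]`_n.
pose y (n : 'I_3) : C := [:: 0; s / 2; - (s / 2)]`_n.
pose u n : 'rV[C]_2 := \row_j (if j == 0 then x n else y n).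
have real2 : 2^-1 \is @Num.real C by rewrite rpredV realn.
apply: (@real_TFF_vectors 2 3 k u (3 / 2)).
- move=> n; apply/mxOverP => i j; rewrite mxE /x /y.
  case: n => [[|[|[|//]]] ?]; case: eqP => _ /=;
  by rewrite ?rpredN ?rpred0 ?rpred1 ?rpredM.
- move=> n; apply/matrixP => i j; rewrite !ord1 !mxE !big_ord_recl big_ord0 !mxE /=.
  by case: n => [[|[|[|//]]] ?]; rewrite /x /y /=; field: ss.
- by rewrite divr_gt0 ?ltr0n.
apply/matrixP => i j; rewrite summxE !big_ord_recl big_ord0 !mxE !big_ord1 !mxE.
by case: i j => [[|[|//]] ?] [[|[|//]] ?];
  rewrite /x /y /= ?mulr0n ?mulr1n; field: ss.
Qed.

End Constructions.

(** * Clearing denominators in the conditions on R *)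

Lemma rat_eq_div (D R m n : nat) : (0 < m)%N ->
  ((R%:R : rat) == n%:R * D%:R / m%:R) = (n * D == m * R)%N.
Proof.
move=> m_gt0; have m0 : m%:R != 0 :> rat by rewrite pnatr_eq0 -lt0n.
by rewrite -(inj_eq (mulIf m0)) divfK // -!natrM eqr_nat mulnC eq_sym.
Qed.


(** Division in [rat] is exact, so D / 2 is a true half even for odd D. *)
Lemma TFF2_ratP (D R : nat) :
  reflect (D = (2 * R)%N \/ D = R) ((R%:R : rat) \in [:: D%:R / 2; D%:R]).
Proof.
have := @rat_eq_div D R 2 1 isT; rewrite !mul1r mul1n => E.
rewrite !inE E eqr_nat (eq_sym R); apply: (iffP orP).
  by case=> /eqP; [left | right].
by case=> ->; rewrite eqxx; [left | right].
Qed.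

Lemma TFF3_ratP (D R : nat) :
  reflect [\/ D = (3 * R)%N, D = (2 * R)%N, (2 * D)%N = (3 * R)%N | D = R]
    ((R%:R : rat) \in [:: D%:R / 3; D%:R / 2; 2 * D%:R / 3; D%:R]).
Proof.
have := @rat_eq_div D R 3 1 isT; rewrite !mul1r mul1n => E1.
have := @rat_eq_div D R 2 1 isT; rewrite !mul1r mul1n => E2.
rewrite !inE E1 E2 (@rat_eq_div D R 3 2) // eqr_nat (eq_sym R).
apply: (iffP or4P).
  by case=> /eqP; [constructor 1 | constructor 2 | constructor 3 | constructor 4].
by case=> /eqP; [constructor 1 | constructor 2 | constructor 3 | constructor 4].
Qed.

Theorem theorem3p2 (K : realType) (D R : nat) (D_gt0 : (0 < D)%N) (R_gt0 : (0 < R)%N) :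
  [/\ TFF_exists K[i] D 2 R <-> (R%:R : rat) \in [:: D%:R / 2; D%:R],
      forall (H : vectType K[i]) (form : {dot H for Num.conj}) (U : 'I_2 -> {vspace H}),
        is_TFF D R form U -> equi_isoclinic form U
    & (R%:R : rat) \in [:: D%:R / 2; D%:R] -> real_TFF_exists K[i] D 2 R]
  /\
  [/\ TFF_exists K[i] D 3 R <->
        (R%:R : rat) \in [:: D%:R / 3; D%:R / 2; 2 * D%:R / 3; D%:R],
      forall (H : vectType K[i]) (form : {dot H for Num.conj}) (U : 'I_3 -> {vspace H}),
        is_TFF D R form U ->
        (R%:R : rat) \in [:: D%:R / 3; D%:R / 2; D%:R] -> equi_isoclinic form U,
      forall (H : vectType K[i]) (form : {dot H for Num.conj}) (U : 'I_3 -> {vspace H}),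
        is_TFF D R form U ->
        (R%:R : rat) = 2 * D%:R / 3 -> equichordal form U
    & (R%:R : rat) \in [:: D%:R / 3; D%:R / 2; 2 * D%:R / 3; D%:R] ->
        real_TFF_exists K[i] D 3 R].
Proof.
have ex_real N : real_TFF_exists K[i] D N R -> TFF_exists K[i] D N R.
  by move=> [H [form [U [UTFF _]]]]; exists H, form, U.
have real2 : (R%:R : rat) \in [:: D%:R / 2; D%:R] -> real_TFF_exists K[i] D 2 R.
  move=> /TFF2_ratP[-> | ->]; first exact: real_TFF_partition.
  exact: real_TFF_full.
have real3 : (R%:R : rat) \in [:: D%:R / 3; D%:R / 2; 2 * D%:R / 3; D%:R] ->
    real_TFF_exists K[i] D 3 R.
  move=> /TFF3_ratP[-> | -> | DR | ->].
  - exact: real_TFF_partition.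
  - exact: real_TFF_mercedes_benz.
  (* From 2 D = 3 R, coprimality of 2 and 3 gives D = 3 k and R = 2 k: complements of the coordinate
     lines in dimension 3, tensored with the identity of size k. *)
  - have /dvdnP[k Dk] : (3 %| D)%N.
      by rewrite -(@Gauss_dvdr 3 2) // DR dvdn_mulr.
    have -> : R = (2 * k)%N.
      by apply/eqP; rewrite -(eqn_pmul2l (isT : (0 < 3)%N)) -DR Dk mulnA mulnC.
    by rewrite Dk mulnC; exact: (@real_TFF_complement _ 3).
  - exact: real_TFF_full.
do 2 split=> //.
- split=> [[H [form [U UTFF]]] | /real2/ex_real //].
  by apply/TFF2_ratP; exact: TFF2_dim UTFF.
- by move=> H form U; exact: TFF2_equi_isoclinic.
- split=> [[H [form [U UTFF]]] | /real3/ex_real //].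
  by apply/TFF3_ratP; exact: TFF3_dim UTFF.
- move=> H form U UTFF Rin; apply: TFF3_equi_isoclinic UTFF _ => // DR.
  (* The equation 2 D = 3 R makes D larger than R, which excludes D = R; D = 3 R and D = 2 R would
     give 6 R = 3 R and 4 R = 3 R, impossible for positive R. *)
  have D_lt : (R < D)%N by rewrite -(ltn_pmul2l (isT : (0 < 2)%N)) DR ltn_pmul2r.
  move: Rin DR; rewrite !inE.
  have := @rat_eq_div D R 3 1 isT; rewrite !mul1r mul1n => ->.
  have := @rat_eq_div D R 2 1 isT; rewrite !mul1r mul1n => ->.
  rewrite eqr_nat (ltn_eqF D_lt) orbF => /orP[] /eqP -> /eqP.
    by rewrite mulnA eqn_pmul2r.
  by rewrite mulnA eqn_pmul2r.
- by move=> H form U UTFF _; apply: TFF3_equichordal UTFF.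
Qed.
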